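(* Let $\mathcal{I}$ be an instance with class formula $\Delta$, and assume some instance $\mathcal{I}'$ satisfies $\mathcal{I}'\not\models\Delta$. Then a necessary reason (NR) $\sigma$ for the decision on $\mathcal{I}$ identifies a shortest flip to the decision (i.e. some $\sigma$-violation of $\mathcal{I}$ is a shortest flip to the decision on $\mathcal{I}$) if and only if $\sigma$ is a shortest NR, i.e. there is no NR $\sigma'$ with $|\mathrm{vars}(\sigma')|<|\mathrm{vars}(\sigma)|$. Consequently, the robustness of the decision on $\mathcal{I}$ equals $|\mathrm{vars}(\sigma)|$ for any shortest NR $\sigma$.
   Context: There is a finite set of variables, each variable $X$ having a finite set of at least two states. An $X$-literal is a nonempty proper subset of the states of $X$ (true when the state of $X$ lies in it); it is simple if it is a singleton. A clause is a disjunction of literals, written with at most one literal per variable. An NNF is a formula built from literals and constants with $\wedge,\vee$ only. $\mathrm{vars}(\cdot)$ is the set of variables occurring in a formula. An implicate of a formula is a (non-valid) clause implied by it; it is prime if no other implicate implies it. An instance $\mathcal{I}$ is a conjunction of one simple literal for each variable; its class formula $\Delta$ is a formula with $\mathcal{I}\models\Delta$ encoding the instances in the class of $\mathcal{I}$. The complete reason for the decision on $\mathcal{I}$ is (up to equivalence) the weakest NNF that implies $\Delta$ and all of whose literals are contained in $\mathcal{I}$; the necessary reasons (NRs) for the decision are the prime implicates of the complete reason. For instances $\mathcal{I},\mathcal{I}'$, $\mathrm{Dvars}(\mathcal{I},\mathcal{I}')$ is the set of variables on which they disagree. For a clause $\sigma$ with $\mathcal{I}\models\sigma$, an instance $\mathcal{I}'$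 is a $\sigma$-violation of $\mathcal{I}$ if $\mathrm{vars}(\sigma)=\mathrm{Dvars}(\mathcal{I},\mathcal{I}')$ and $\mathcal{I}'\not\models\sigma$. An instance $\mathcal{I}'$ is a shortest flip to the decision on $\mathcal{I}$ if $\mathcal{I}'\not\models\Delta$ and no instance $\mathcal{I}''$ satisfies $\mathcal{I}''\not\models\Delta$ and $|\mathrm{Dvars}(\mathcal{I},\mathcal{I}'')|<|\mathrm{Dvars}(\mathcal{I},\mathcal{I}')|$. The robustness of the decision on $\mathcal{I}$ is $|\mathrm{Dvars}(\mathcal{I},\mathcal{I}')|$ for a shortest flip $\mathcal{I}'$. *)

(* Defs.v *)
From mathcomp Require Import all_boot.

Set Implicit Arguments.
Unset Strict Implicit.
Unset Printing Implicit Defensive.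

(* [V] is the set of variables and [S X] the set of states of the variable    *)
(* [X].  The assumption that every variable has at least two states is a      *)
(* hypothesis of the theorem, not part of these definitions.                  *)

Definition literal (V : finType) (S : V -> finType) :=
  {p : {X : V & {set S X}} |
    (tagged p != set0) && (tagged p \proper [set: S (tag p)])}.

Definition lit_var (V : finType) (S : V -> finType) (l : literal S) : V :=
  tag (val l).

Definition lit_states (V : finType) (S : V -> finType) (l : literal S) :
    {set S (lit_var l)} :=
  tagged (val l).

(* A conjunction of one simple literal per variable is given by the state it  *)
(* selects for each variable.  Instances are also the valuations (worlds) at  *)
(* which formulas are evaluated, so "I |= F" is [sat I F].                    *)
Definition instance (V : finType) (S : V -> finType) :=
  {dffun forall X : V, S X}.

Definition inst_lits (V : finType) (S : V -> finType) (I : instance S) :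
    {set literal S} :=
  [set l | lit_states l == [set I (lit_var l)]].

Inductive formula (V : finType) (S : V -> finType) : Type :=
| FTrue
| FFalse
| FLit of literal S
| FNot of formula S
| FAnd of formula S & formula S
| FOr of formula S & formula S.

Arguments FTrue {V S}.
Arguments FFalse {V S}.

Fixpoint nnf (V : finType) (S : V -> finType) (F : formula S) : bool :=
  match F with
  | FTrue | FFalse | FLit _ => true
  | FNot _ => false
  | FAnd F1 F2 | FOr F1 F2 => nnf F1 && nnf F2
  end.

Fixpoint lits (V : finType) (S : V -> finType) (F : formula S) :
    seq (literal S) :=
  match F with
  | FTrue | FFalse => [::]
  | FLit l => [:: l]
  | FNot F1 => lits F1
  | FAnd F1 F2 | FOr F1 F2 => lits F1 ++ lits F2
  end.

Definition vars (V : finType) (S : V -> finType) (F : formula S) : {set V} :=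
  [set X in map (@lit_var V S) (lits F)].

Fixpoint sat (V : finType) (S : V -> finType) (w : instance S)
    (F : formula S) : bool :=
  match F with
  | FTrue => true
  | FFalse => false
  | FLit l => w (lit_var l) \in lit_states l
  | FNot F1 => ~~ sat w F1
  | FAnd F1 F2 => sat w F1 && sat w F2
  | FOr F1 F2 => sat w F1 || sat w F2
  end.

Definition valid (V : finType) (S : V -> finType) (F : formula S) : Prop :=
  forall w : instance S, sat w F.

Definition entails (V : finType) (S : V -> finType) (F G : formula S) : Prop :=
  forall w : instance S, sat w F -> sat w G.

(* A set of literals, with at most one literal per variable, read             *)
(* disjunctively.  Two clauses are logically equivalent only if they are      *)
(* equal, so [tau != sigma] is a faithful reading of "other" in the           *)
(* definition of a prime implicate.                                           *)
Definition clause (V : finType) (S : V -> finType) :=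
  {c : {set literal S} |
    [forall l in c, forall l' in c, (lit_var l == lit_var l') ==> (l == l')]}.

Definition clause_formula (V : finType) (S : V -> finType) (sigma : clause S) :
    formula S :=
  \big[@FOr V S/FFalse]_(l in val sigma) FLit l.

Coercion clause_formula : clause >-> formula.

Definition implicate (V : finType) (S : V -> finType) (F : formula S)
    (sigma : clause S) : Prop :=
  ~ valid sigma /\ entails F sigma.

Definition prime_implicate (V : finType) (S : V -> finType) (F : formula S)
    (sigma : clause S) : Prop :=
  implicate F sigma /\
  ~ (exists tau : clause S,
       [/\ tau != sigma, implicate F tau & entails tau sigma]).

Definition reason_candidate (V : finType) (S : V -> finType)
    (Delta : formula S) (I : instance S) (G : formula S) : Prop :=
  [/\ nnf G, {subset lits G <= inst_lits I} & entails G Delta].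

(* Determined up to equivalence; see [complete_reason_exists] and             *)
(* [complete_reason_unique] below.                                            *)
Definition complete_reason (V : finType) (S : V -> finType)
    (Delta : formula S) (I : instance S) (G : formula S) : Prop :=
  reason_candidate Delta I G /\
  (forall G' : formula S, reason_candidate Delta I G' -> entails G' G).

Definition necessary_reason (V : finType) (S : V -> finType)
    (Delta : formula S) (I : instance S) (sigma : clause S) : Prop :=
  exists2 G : formula S, complete_reason Delta I G & prime_implicate G sigma.

Definition shortest_NR (V : finType) (S : V -> finType)
    (Delta : formula S) (I : instance S) (sigma : clause S) : Prop :=
  necessary_reason Delta I sigma /\
  ~ (exists2 sigma' : clause S, necessary_reason Delta I sigma' &
       #|vars sigma'| < #|vars sigma|).

Definition Dvars (V : finType) (S : V -> finType) (I I' : instance S) :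
    {set V} :=
  [set X | I X != I' X].

Definition violation (V : finType) (S : V -> finType) (sigma : clause S)
    (I I' : instance S) : bool :=
  [&& sat I sigma, vars sigma == Dvars I I' & ~~ sat I' sigma].

Definition shortest_flip (V : finType) (S : V -> finType)
    (Delta : formula S) (I I' : instance S) : bool :=
  ~~ sat I' Delta &&
  ~~ [exists I'' : instance S,
        ~~ sat I'' Delta && (#|Dvars I I''| < #|Dvars I I'|)].

Definition identifies_shortest_flip (V : finType) (S : V -> finType)
    (Delta : formula S) (I : instance S) (sigma : clause S) : Prop :=
  exists2 I' : instance S, violation sigma I I' & shortest_flip Delta I I'.

(* All shortest flips give the same value; 0 is a junk value for the case of  *)
(* a valid [Delta], where there is no flip.                                   *)
Definition robustness (V : finType) (S : V -> finType)
    (Delta : formula S) (I : instance S) : nat :=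
  if [pick I' : instance S | shortest_flip Delta I I'] is Some I'
  then #|Dvars I I'| else 0.

Lemma complete_reason_unique (V : finType) (S : V -> finType)
    (Delta : formula S) (I : instance S) (G G' : formula S) :
  complete_reason Delta I G -> complete_reason Delta I G' ->
  entails G G' /\ entails G' G.
Proof. by move=> [cG wG] [cG' wG']; split; [apply: wG' | apply: wG]. Qed.

Lemma sat_bigAnd (V : finType) (S : V -> finType) (L : {set literal S})
    (w : instance S) :
  sat w (\big[@FAnd V S/FTrue]_(l in L) FLit l) =
  [forall l in L, w (lit_var l) \in lit_states l].
Proof. by rewrite (big_morph (sat w) (id1 := true) (op1 := andb)) ?big_andE. Qed.

Lemma sat_bigOr (V : finType) (S : V -> finType) (T : finType) (P : pred T)
    (F : T -> formula S) (w : instance S) :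
  sat w (\big[@FOr V S/FFalse]_(i | P i) F i) = [exists (i | P i), sat w (F i)].
Proof. by rewrite (big_morph (sat w) (id1 := false) (op1 := orb)) ?big_orE. Qed.

Lemma sat_mono (V : finType) (S : V -> finType) (G : formula S)
    (w w' : instance S) :
  nnf G ->
  {in lits G, forall l, w (lit_var l) \in lit_states l ->
                        w' (lit_var l) \in lit_states l} ->
  sat w G -> sat w' G.
Proof.
elim: G => //= [l _ H|F IHF G IHG /andP[nF nG] H|F IHF G IHG /andP[nF nG] H].
- by apply: H; rewrite inE.
  case/andP=> sF sG; apply/andP; split.
    by apply: IHF sF => // l hl; apply: H; rewrite mem_cat hl.
  by apply: IHG sG => // l hl; apply: H; rewrite mem_cat hl orbT.
- case/orP=> s; apply/orP; [left; apply: IHF s | right; apply: IHG s] => // l hl;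
  by apply: H; rewrite mem_cat hl ?orbT.
Qed.

Lemma complete_reason_exists (V : finType) (S : V -> finType)
    (Delta : formula S) (I : instance S) :
  exists G : formula S, complete_reason Delta I G.
Proof.
pose C (L : {set literal S}) := \big[@FAnd V S/FTrue]_(l in L) FLit l.
pose P (L : {set literal S}) := (L \subset inst_lits I) &&
            [forall w : instance S, sat w (C L) ==> sat w Delta].
exists (\big[@FOr V S/FFalse]_(L | P L) C L); split; first split.
- apply: (big_ind (@nnf V S)) => [//|F G nF nG|L _]; first by rewrite /= nF nG.
  by apply: (big_ind (@nnf V S)) => // F G nF nG; rewrite /= nF nG.
- pose Q F := {subset lits F <= inst_lits I}.
  have QU F G : Q F -> Q G -> {subset lits F ++ lits G <= inst_lits I}.
    by move=> qF qG l; rewrite mem_cat => /orP[/qF|/qG].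
  apply: (big_ind Q) => [//|F G|L /andP[/subsetP sL _]]; first exact: QU.
  apply: (big_ind Q) => [//|F G|l lL]; first exact: QU.
  by move=> l'; rewrite inE => /eqP->; apply: sL.
- move=> w; rewrite sat_bigOr => /existsP[L /andP[/andP[_ /forallP H] sL]].
  exact: (implyP (H w)).
move=> G' [nG' lG' eG'] w sG'; rewrite sat_bigOr; apply/existsP.
exists [set l in inst_lits I | w (lit_var l) \in lit_states l].
apply/andP; split; last first.
  by rewrite sat_bigAnd; apply/forall_inP => l; rewrite inE => /andP[].
apply/andP; split; first by apply/subsetP => l; rewrite inE => /andP[].
apply/forallP => w'; apply/implyP; rewrite sat_bigAnd => /forall_inP H.
apply: eG'; apply: sat_mono sG' => // l hl wl.
by apply: H; rewrite inE lG'.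
Qed.

(* Main.v *)
Require Import Defs.
From mathcomp Require Import all_boot.

Set Implicit Arguments.
Unset Strict Implicit.
Unset Printing Implicit Defensive.

(** Call a set of variables flippable when changing the instance on (some of)
    these variables can change the decision.  The complete reason holds at a
    world exactly when the set of variables on which the world departs from the
    instance is not flippable.  Hence the necessary reasons are exactly the
    disjunctions of the literals of the instance over the inclusion-minimal
    flippable sets; the latter are sets of disagreement of flips, and the
    flippable sets of least cardinality are those of the shortest flips. *)

Definition flippable (V : finType) (S : V -> finType) (Delta : formula S)
    (I : instance S) (D : {set V}) : bool :=
  [exists w : instance S, (Dvars I w \subset D) && ~~ sat w Delta].

(** * Literals of the instance and sets of disagreement *)

Lemma sat_clause (V : finType) (S : V -> finType) (sigma : clause S)
    (w : instance S) :
  sat w sigma = [exists l in val sigma, w (lit_var l) \in lit_states l].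
Proof. exact: sat_bigOr. Qed.

Lemma vars_clause (V : finType) (S : V -> finType) (sigma : clause S) :
  vars sigma = [set lit_var l | l in val sigma].
Proof.
apply/setP => X.
have -> : (X \in vars sigma) = [exists l in val sigma, X == lit_var l].
  rewrite /clause_formula (big_morph (fun F => X \in vars F)
    (id1 := false) (op1 := orb)) ?big_orE.
  - by apply: eq_existsb => l; rewrite !inE.
  - by move=> F G; rewrite !inE /= map_cat mem_cat.
  - by rewrite inE.
apply/exists_inP/imsetP => [[l lh /eqP ->]|[l lh ->]]; by exists l.
Qed.

Lemma inst_lit_sat (V : finType) (S : V -> finType) (I w : instance S)
    (l : literal S) :
  l \in inst_lits I ->
  (w (lit_var l) \in lit_states l) = (lit_var l \notin Dvars I w).
Proof. by rewrite inE => /eqP->; rewrite !inE negbK eq_sym. Qed.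

Lemma inst_lits_inj (V : finType) (S : V -> finType) (I : instance S) :
  {in inst_lits I &, injective (@lit_var V S)}.
Proof.
move=> l l'; rewrite !inE /lit_states /lit_var => /eqP lI /eqP l'I ll'.
apply: val_inj; move: lI l'I ll'.
by case: (val l) (val l') => [X s] [Y t] /= -> -> {s t} XY; case: Y / XY.
Qed.

Lemma inst_lit_exists (V : finType) (S : V -> finType)
    (hS : forall X : V, 1 < #|S X|) (I : instance S) (X : V) :
  exists2 l, l \in inst_lits I & lit_var l = X.
Proof.
pose p := Tagged (fun X => {set S X}) [set I X].
have hp : (tagged p != set0) && (tagged p \proper [set: S (tag p)]).
  by rewrite -card_gt0 properEcard subsetT /= cards1 cardsT hS.
by exists (exist _ p hp); rewrite ?inE.
Qed.

Lemma Dvars_sub (V : finType) (S : V -> finType) (I w : instance S)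
    (D : {set V}) :
  (forall X, X \notin D -> w X = I X) -> Dvars I w \subset D.
Proof.
move=> h; apply/subsetP => X; rewrite inE.
by apply: contraNT => /h->.
Qed.

Lemma Dvars_surj (V : finType) (S : V -> finType)
    (hS : forall X : V, 1 < #|S X|) (I : instance S) (D : {set V}) :
  exists w : instance S, Dvars I w = D.
Proof.
have other X : exists s : S X, s != I X.
  have /card_gt1P [x [y [_ _ xy]]] := hS X.
  have [xI|] := eqVneq x (I X); last by exists x.
  by exists y; rewrite -xI eq_sym.
exists [ffun X => if X \in D then xchoose (other X) else I X].
apply/setP => X; rewrite inE ffunE.
by case: ifP => _; rewrite ?eqxx // eq_sym (xchooseP (other X)).
Qed.

(** Left to right is monotonicity: [G] is an NNF over literals of [I], so it survives at every world
    whose disagreement with [I] shrinks, and there it forces [Delta]. The converse uses that [G] is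
    weakest. *)
Lemma complete_reason_sat (V : finType) (S : V -> finType)
    (hS : forall X : V, 1 < #|S X|) (Delta : formula S) (I : instance S)
    (G : formula S) (w : instance S) :
  complete_reason Delta I G -> sat w G = ~~ flippable Delta I (Dvars I w).
Proof.
move=> [[nG lG eG] weakest]; apply/idP/idP => [sG|nflip].
  apply/existsPn => w'; rewrite negb_and negbK -implybE; apply/implyP => sub.
  apply: eG; apply: sat_mono sG => // l /lG lI.
  by rewrite !(inst_lit_sat _ lI); apply: contra; apply: (subsetP sub).
(* The conjunction of the literals of [I] true at [w] holds only at worlds that disagree with [I]
   inside [Dvars I w]. No flip lies there, so it is a reason candidate. *)
pose L := [set l in inst_lits I | lit_var l \notin Dvars I w].
have LI l : l \in L -> l \in inst_lits I by rewrite inE => /andP[].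
apply: (weakest (\big[@FAnd V S/FTrue]_(l in L) FLit l)); last first.
  rewrite sat_bigAnd; apply/forall_inP => l lL.
  by rewrite (inst_lit_sat _ (LI _ lL)); move: lL; rewrite inE => /andP[].
split.
- by apply: (big_ind (@nnf V S)) => // F F' nF nF'; rewrite /= nF nF'.
- apply: (big_ind (fun F => {subset lits F <= inst_lits I})) => //.
    by move=> F F' hF hF' l; rewrite mem_cat => /orP[/hF|/hF'].
  by move=> l lL l'; rewrite inE => /eqP->; apply: LI.
move=> w'; rewrite sat_bigAnd => /forall_inP h.
have /existsPn/(_ w') := nflip; rewrite negb_and negbK => /orP[|//].
case/negP; apply/subsetP => X; apply: contraLR => Xw.
have [l lI lX] := inst_lit_exists hS I X; rewrite -lX -(inst_lit_sat _ lI).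
by apply: h; rewrite inE lI lX.
Qed.

(** * Clauses over the literals of the instance, and necessary reasons *)

Lemma inst_clause_subproof (V : finType) (S : V -> finType) (I : instance S)
    (D : {set V}) (c := [set l in inst_lits I | lit_var l \in D]) :
  [forall l in c, forall l' in c, (lit_var l == lit_var l') ==> (l == l')].
Proof.
apply/forall_inP => l; rewrite inE => /andP[lI _].
apply/forall_inP => l'; rewrite inE => /andP[l'I _].
by apply/implyP => /eqP/(inst_lits_inj lI l'I)->.
Qed.

Definition inst_clause (V : finType) (S : V -> finType) (I : instance S)
    (D : {set V}) : clause S :=
  exist _ [set l in inst_lits I | lit_var l \in D] (inst_clause_subproof I D).

Lemma mem_inst_clause (V : finType) (S : V -> finType) (I : instance S)
    (D : {set V}) (l : literal S) :
  (l \in val (inst_clause I D)) = (l \in inst_lits I) && (lit_var l \in D).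
Proof. by rewrite in_set. Qed.

Lemma vars_inst_clause (V : finType) (S : V -> finType)
    (hS : forall X : V, 1 < #|S X|) (I : instance S) (D : {set V}) :
  vars (inst_clause I D) = D.
Proof.
apply/setP => X; rewrite vars_clause; apply/imsetP/idP => [[l lD ->]|XD].
  by move: lD; rewrite mem_inst_clause => /andP[].
have [l lI lX] := inst_lit_exists hS I X.
by exists l => //; rewrite mem_inst_clause lI lX.
Qed.

Lemma sat_inst_clause (V : finType) (S : V -> finType)
    (hS : forall X : V, 1 < #|S X|) (I w : instance S) (D : {set V}) :
  sat w (inst_clause I D) = ~~ (D \subset Dvars I w).
Proof.
rewrite sat_clause; apply/exists_inP/subsetPn => [[l]|[X XD Xw]].
  rewrite mem_inst_clause => /andP[lI lD]; rewrite (inst_lit_sat _ lI).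
  by exists (lit_var l).
have [l lI lX] := inst_lit_exists hS I X.
by exists l; rewrite ?mem_inst_clause ?(inst_lit_sat _ lI) ?lI lX.
Qed.

(** These are the variables on which falsifying [sigma] forces a departure from [I]; the remaining
    literals of [sigma] are already false at [I]. *)
Definition agree_vars (V : finType) (S : V -> finType) (I : instance S)
    (sigma : clause S) : {set V} :=
  [set lit_var l | l in val sigma & I (lit_var l) \in lit_states l].

Lemma mem_agree_vars (V : finType) (S : V -> finType) (I : instance S)
    (sigma : clause S) (l : literal S) :
  l \in val sigma ->
  (lit_var l \in agree_vars I sigma) = (I (lit_var l) \in lit_states l).
Proof.
move=> ls; apply/imsetP/idP => [[l' /[!inE] /andP[l's l'I] ll']|lI].
  have /forall_inP/(_ l ls)/forall_inP/(_ l' l's) := valP sigma.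
  by move/implyP/(_ (introT eqP ll'))/eqP ->.
by exists l => //; rewrite inE ls lI.
Qed.

(* The witness falsifies sigma by departing from the instance only where the
   instance satisfies the literal of sigma. *)
Lemma implicate_flippable (V : finType) (S : V -> finType)
    (hS : forall X : V, 1 < #|S X|) (Delta : formula S) (I : instance S)
    (G : formula S) (sigma : clause S) :
  complete_reason Delta I G -> implicate G sigma ->
  flippable Delta I (agree_vars I sigma).
Proof.
move=> cG [nvalid eG].
have /forallPn [w0 w0s] : ~~ [forall w : instance S, sat w sigma].
  by apply/forallP.
pose w : instance S :=
  [ffun X => if X \in agree_vars I sigma then w0 X else I X].
have ws : ~~ sat w sigma.
  rewrite sat_clause; apply/exists_inPn => l ls.
  rewrite ffunE; case: ifP => lA; last by rewrite -(mem_agree_vars _ ls) lA.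
  by move: w0s; rewrite sat_clause => /exists_inPn; apply.
have : ~~ sat w G by apply: contra ws; apply: eG.
rewrite (complete_reason_sat hS _ cG) negbK => /existsP [w' /andP[sub w'D]].
apply/existsP; exists w'; rewrite w'D andbT; apply: subset_trans sub _.
by apply: Dvars_sub => X /negbTE XA; rewrite ffunE XA.
Qed.

(** A world falsifying the clause departs from [I] on all of [D]; supersets of flippable sets are
    flippable, so the complete reason fails there too. *)
Lemma flippable_implicate (V : finType) (S : V -> finType)
    (hS : forall X : V, 1 < #|S X|) (Delta : formula S) (I : instance S)
    (G : formula S) (D : {set V}) :
  complete_reason Delta I G -> flippable Delta I D ->
  implicate G (inst_clause I D).
Proof.
move=> cG flipD; split.
  have [w wD] := Dvars_surj hS I D.
  by move/(_ w); rewrite sat_inst_clause // wD subxx.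
move=> w; rewrite (complete_reason_sat hS _ cG) sat_inst_clause //.
apply: contra => sub; case/existsP: flipD => w' /andP[w'D nD].
by apply/existsP; exists w'; rewrite nD (subset_trans w'D).
Qed.

(** A literal of [sigma] true at [I] contains the state of [I], so the simple literal of [I] is
    stronger. Hence any implicate can be strengthened to an instance clause. *)
Lemma agree_vars_entails (V : finType) (S : V -> finType) (I : instance S)
    (sigma : clause S) :
  entails (inst_clause I (agree_vars I sigma)) sigma.
Proof.
move=> w; rewrite !sat_clause => /exists_inP [l].
rewrite mem_inst_clause => /andP[lI /imsetP [l' /[!inE] /andP[l's l'I] ll']] wl.
apply/exists_inP; exists l' => //; move: wl.
by rewrite (inst_lit_sat _ lI) ll' inE negbK => /eqP <-.
Qed.

(** Start from a world [v] departing from [I] exactly on [D], where the instance clause is false.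
    Moving one variable into a literal of [tau] must make that clause true, which is possible only
    by restoring the state of [I] on a variable of [D]. *)
Lemma entails_inst_clause (V : finType) (S : V -> finType)
    (hS : forall X : V, 1 < #|S X|) (I : instance S) (D : {set V})
    (tau : clause S) :
  entails tau (inst_clause I D) -> val tau \subset val (inst_clause I D).
Proof.
move=> ent; apply/subsetP => l lt; rewrite mem_inst_clause.
have [v vD] := Dvars_surj hS I D.
have key s : s \in lit_states l -> s = I (lit_var l) /\ lit_var l \in D.
  move=> sl; pose w : instance S := finfun (dfwith v s).
  have /ent : sat w tau.
    by rewrite sat_clause; apply/exists_inP; exists l; rewrite // ffunE dfwith_in.
  rewrite sat_inst_clause // => /subsetPn [Y]; rewrite inE negbK ffunE.
  have [<- lD|neq YD] := eqVneq (lit_var l) Y; first by rewrite dfwith_in => /eqP ->.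
  by rewrite dfwith_out // => /eqP IY; move: YD; rewrite -vD inE IY eqxx.
(* Nonemptiness of the literal supplies a state to which [key] applies. *)
have /andP[/set0Pn [s sl] _] := valP l.
have [sI lD] := key s sl; rewrite lD andbT inE; apply/eqP/setP => t.
by rewrite inE; apply/idP/eqP => [/key[]|->] //; rewrite -sI.
Qed.

(** A prime implicate must equal its strengthening over [agree_vars]. Among instance clauses a
    smaller set gives a stronger clause, so primality turns into minimality of the set. *)
Lemma necessary_reasonP (V : finType) (S : V -> finType)
    (hS : forall X : V, 1 < #|S X|) (Delta : formula S) (I : instance S)
    (sigma : clause S) :
  necessary_reason Delta I sigma <->
  exists2 D, minset (flippable Delta I) D & sigma = inst_clause I D.
Proof.
split=> [[G cG [impl prime]]|[D /minsetP [flipD minD] ->]].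
  pose D := agree_vars I sigma.
  have flipD : flippable Delta I D by apply: implicate_flippable impl.
  have sD : sigma = inst_clause I D.
    apply/eqP; rewrite eq_sym; apply/negPn/negP => neq; apply: prime.
    exists (inst_clause I D); split=> //; last exact: agree_vars_entails.
    exact: flippable_implicate cG flipD.
  exists D => //; apply/minsetP; split=> // E flipE sub.
  apply/eqP/negPn/negP => neq; apply: prime; exists (inst_clause I E); split.
  - apply: contraNneq neq => eE.
    by rewrite -(vars_inst_clause hS I E) eE sD vars_inst_clause.
  - exact: flippable_implicate cG flipE.
  move=> w; rewrite sD !sat_inst_clause //.
  by apply: contra; apply: subset_trans.
have [G cG] := complete_reason_exists Delta I.
exists G => //; split; first exact: flippable_implicate cG flipD.
case=> tau [/eqP neq impl ent]; apply: neq; apply: val_inj.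
have sub := entails_inst_clause hS ent.
apply/eqP; rewrite eqEsubset sub /=; apply/subsetP => l lD.
(* [agree_vars I tau] is flippable because [tau] is an implicate, so minimality makes it all of [D];
   [tau] then has a literal on every variable of [D]. *)
have agreeD : agree_vars I tau = D.
  apply: minD (implicate_flippable hS cG impl) _.
  apply/subsetP => _ /imsetP [l' /[!inE] /andP[l't _] ->].
  by have := subsetP sub l' l't; rewrite mem_inst_clause => /andP[].
move: lD; rewrite mem_inst_clause -{1}agreeD => /andP[lI].
case/imsetP => l' /[!inE] /andP[l't _] ll'; have := subsetP sub l' l't.
by rewrite mem_inst_clause => /andP[l'I _]; rewrite (inst_lits_inj lI l'I ll').
Qed.

(** * Shortest flips and minimal flippable sets *)

Lemma flippable_Dvars (V : finType) (S : V -> finType) (Delta : formula S)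
    (I w : instance S) :
  ~~ sat w Delta -> flippable Delta I (Dvars I w).
Proof. by move=> nD; apply/existsP; exists w; rewrite subxx. Qed.

Lemma shortest_flip_leq (V : finType) (S : V -> finType) (Delta : formula S)
    (I I' : instance S) (D : {set V}) :
  shortest_flip Delta I I' -> flippable Delta I D -> #|Dvars I I'| <= #|D|.
Proof.
move=> /andP[_ /existsPn min] /existsP [w /andP[sub nD]].
have := min w; rewrite nD -leqNgt => /leq_trans; apply.
exact: subset_leq_card.
Qed.

Lemma shortest_flip_minset (V : finType) (S : V -> finType) (Delta : formula S)
    (I I' : instance S) :
  shortest_flip Delta I I' -> minset (flippable Delta I) (Dvars I I').
Proof.
move=> sI'; have /andP[nD _] := sI'.
apply/minsetP; split=> [|E flipE sub]; first exact: flippable_Dvars.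
by apply/eqP; rewrite eqEcard sub (shortest_flip_leq sI').
Qed.

Lemma shortest_flip_exists (V : finType) (S : V -> finType) (Delta : formula S)
    (I w : instance S) :
  ~~ sat w Delta -> exists I', shortest_flip Delta I I'.
Proof.
move=> nD; case: (@arg_minnP _ w (fun w => ~~ sat w Delta) (fun w => #|Dvars I w|) nD) => I' nI' min.
exists I'; rewrite /shortest_flip nI'; apply/existsPn => J.
by rewrite negb_and -leqNgt -implybE; apply/implyP/min.
Qed.

Lemma minset_flippable_witness (V : finType) (S : V -> finType)
    (Delta : formula S) (I : instance S) (D : {set V}) :
  minset (flippable Delta I) D ->
  exists2 w : instance S, Dvars I w = D & ~~ sat w Delta.
Proof.
case/minsetP => /existsP [w /andP[sub nD]] min.
by exists w => //; apply: min => //; apply: flippable_Dvars.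
Qed.

(** The size of a shortest flip bounds every necessary reason from below, and the instance clause
    over [Dvars I I'] attains the bound. *)
Lemma shortest_NR_card (V : finType) (S : V -> finType)
    (hS : forall X : V, 1 < #|S X|) (Delta : formula S) (I I' : instance S)
    (sigma : clause S) :
  shortest_flip Delta I I' -> necessary_reason Delta I sigma ->
  shortest_NR Delta I sigma <-> #|vars sigma| = #|Dvars I I'|.
Proof.
move=> sI' NRs.
have leNR tau : necessary_reason Delta I tau -> #|Dvars I I'| <= #|vars tau|.
  move=> /(necessary_reasonP hS) [D /minsetP [flipD _] ->].
  by rewrite vars_inst_clause // (shortest_flip_leq sI').
split=> [[_ shortest]|card]; last first.
  by split=> // -[tau /leNR]; rewrite card leqNgt => /negP.
apply/eqP; rewrite eqn_leq leNR // andbT leqNgt; apply/negP => lt.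
apply: shortest; exists (inst_clause I (Dvars I I')).
  apply/(necessary_reasonP hS); exists (Dvars I I') => //.
  exact: shortest_flip_minset.
by rewrite vars_inst_clause.
Qed.

Theorem mainTheorem4 (V : finType) (S : V -> finType)
    (hS : forall X : V, 1 < #|S X|)
    (Delta : formula S) (I : instance S)
    (hI : sat I Delta)
    (hflip : exists I' : instance S, ~~ sat I' Delta) :
  (forall sigma : clause S, necessary_reason Delta I sigma ->
     (identifies_shortest_flip Delta I sigma <-> shortest_NR Delta I sigma)) /\
  (forall sigma : clause S, shortest_NR Delta I sigma ->
     robustness Delta I = #|vars sigma|).
Proof.
split=> [sigma NRs|sigma short]; last first.
  rewrite /robustness; case: pickP => [I' sI'|none].
    by apply/esym/(shortest_NR_card hS sI') => //; case: short.
  (* The junk value 0 is excluded: some flip exists, hence a shortest one. *)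
  case: hflip => w /(shortest_flip_exists I) [I'].
  by rewrite none.
split=> [[I' /and3P[_ /eqP varsI' _] sI']|].
  by apply/(shortest_NR_card hS sI') => //; rewrite varsI'.
case: hflip => w0 /(shortest_flip_exists I) [I' sI'].
move/(shortest_NR_card hS sI' NRs).
have [D minD ->] := (necessary_reasonP hS _ _ _).1 NRs.
have [w wD nD] := minset_flippable_witness minD.
rewrite vars_inst_clause // => card; exists w.
  rewrite /violation !sat_inst_clause // vars_inst_clause // wD subxx eqxx !andbT.
  (* If [I] falsified the clause, [D] would lie in the empty set [Dvars I I], making [w] equal to
     [I], where [Delta] holds. *)
  apply: contraNN nD => sub; suff -> : w = I by [].
  apply/ffunP => X; apply/eqP; rewrite eq_sym; apply/negPn/negP => neq.
  have := subsetP sub X; rewrite -wD !inE neq eqxx => /(_ isT) //.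
rewrite /shortest_flip nD; apply/existsPn => J.
rewrite negb_and -leqNgt wD card -implybE; apply/implyP => nJ.
by apply: (shortest_flip_leq sI'); apply: flippable_Dvars.
Qed.
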